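(* Let $G$ be a visibility graph with minimum degree $\delta$ and at most four collinear vertices. Then $G$ has vertex-connectivity at least $\frac{2\delta+1}{3}$.
   Context: For a finite set $P$ of points in the plane, two distinct points $v,w$ are visible with respect to $P$ if no point of $P$ lies in the open line segment $vw$. The visibility graph of $P$ has vertex set $P$, with $v,w$ adjacent iff they are visible with respect to $P$. ''At most four collinear vertices'' means no line contains more than four points of $P$. *)

(* Defs.v *)
From mathcomp Require Import all_boot all_order all_algebra.
From mathcomp Require Import finmap boolp classical_sets reals.
Set Implicit Arguments.
Unset Strict Implicit.
Unset Printing Implicit Defensive.
Import Order.TTheory GRing.Theory Num.Theory.
Local Open Scope fset_scope.
Local Open Scope classical_set_scope.
Local Open Scope ring_scope.

Section Graphs.
Variables (T : finType) (e : rel T).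
Implicit Types (x : T) (S : {set T}) (k : nat).

Definition degree x : nat := #|[set y | e x y]%SET|.

(* The default #|T| bounds every degree, so this is the true minimum as soon
   as T is nonempty. *)
Definition min_degree : nat := \big[minn/#|T|]_(x : T) degree x.

Definition connected_on S : bool :=
  [forall x in S, forall y in S,
    connect [rel u v | [&& u \in S, v \in S & e u v]] x y].

(* The condition k < #|T| makes the complete graph on n vertices
   (n - 1)-connected and no more. *)
Definition k_connected k : bool :=
  (k < #|T|)%N && [forall S : {set T}, (#|S| < k)%N ==> connected_on (~: S)%SET].

(* The largest k such that the graph is k-connected. *)
Definition connectivity : nat := \max_(k < #|T| | k_connected k) k.

End Graphs.

Section Visibility.
Variable R : realType.
Implicit Types (v w a d : 'rV[R]_2) (P : {fset 'rV[R]_2}).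

Definition open_segment v w : set 'rV[R]_2 :=
  [set p | exists2 t : R, 0 < t < 1 & p = (1 - t) *: v + t *: w].

Definition visible P v w : Prop :=
  v <> w /\ forall p, p \in P -> ~ open_segment v w p.

Definition visibility_graph P : rel P :=
  fun x y => `[< visible P (val x) (val y) >].

(* The line through a with direction d, for d nonzero. *)
Definition line a d : set 'rV[R]_2 := [set p | exists t : R, p = a + t *: d].

Definition at_most_collinear (k : nat) P : Prop :=
  forall a d, d != 0 -> (#|` [fset p in P | p \in line a d] | <= k)%N.

End Visibility.

Arguments visibility_graph {R} P.

(* Main.v *)
(* Let S be a vertex cut, and let A and B be the two sides. A segment from A to
   B contains a point of S in its interior, for otherwise the consecutive points
   on it would join the two sides. So disjoint open segments between A and B
   give distinct points of S. With n = min(|A|, |B|), a vertex on the smaller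
   side has degree at most n - 1 + |S|; hence the bound follows once |S| >= 2n - 1,
   and it suffices to draw 2n - 1 noncrossing bichromatic edges on n points of A
   and n points of B. A bichromatic line contains a point of S, thus at most
   three of these points.

   The edges are found by induction on n. Let a0, say in A, be a point farthest
   from the origin, so that it is extreme, and sort the other points by angle
   around a0, with weight -1 for A and +1 for B. The total weight is 1, so some
   ray brings the partial sum from at most 0 to at least 1. That ray contains one
   or two points of B and no point of A; let b be the one nearest to a0. If both
   sides of the ray contain points, the two closed sides, both containing a0 and
   b, can be chosen balanced; their drawings share at most the edge a0 b.
   Otherwise a0 b lies on the hull: draw the remaining points by induction, then
   add a0 b and an edge from a0 or b to a point z on the boundary of a half-plane
   that contains all other points but not a0 and b. *)
Require Import Defs.
From mathcomp Require Import all_boot all_order all_algebra.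
From mathcomp Require Import finmap boolp classical_sets reals.
From mathcomp Require Import fintype finset ring lra zify.
Set Implicit Arguments.
Unset Strict Implicit.
Unset Printing Implicit Defensive.
Import Order.TTheory GRing.Theory Num.Theory.
Local Open Scope ring_scope.

(** * Affine forms, segments and crossings on finitely many points *)

Section Plane.
Variables (R : realFieldType) (T : finType) (x y : T -> R).
Hypothesis xy_inj : forall p q, x p = x q -> y p = y q -> p = q.
Implicit Types (f l h : T -> R) (p q : T) (e : T * T) (A B S : {set T})
  (E : {set T * T}) (t : R).

Definition lin (c : R * R * R) p := c.1.1 * x p + c.1.2 * y p + c.2.

Definition affine f := exists c, forall p, f p = lin c p.

(** The affine interpolation of [f] between the ends of [e]. It makes sense at every [t], even where
    no point of [T] sits, and serves for coordinates and affine forms alike. *)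
Definition along f e t := (1 - t) * f e.1 + t * f e.2.

Definition between p e :=
  exists2 t, 0 < t < 1 & x p = along x e t /\ y p = along y e t.

(** The segments are open, so edges with a common end need not meet, while every edge meets itself.
    Noncrossing is therefore phrased as: edges that meet are equal. *)
Definition meet e1 e2 := exists2 st : R * R, (0 < st.1 < 1) && (0 < st.2 < 1) &
  along x e1 st.1 = along x e2 st.2 /\ along y e1 st.1 = along y e2 st.2.

Lemma affine_between f p e : affine f -> between p e ->
  exists2 t, 0 < t < 1 & f p = along f e t.
Proof.
move=> [c fE] [t t01 [xE yE]]; exists t => //.
by rewrite /along !fE /lin xE yE /along; ring.
Qed.

Lemma affine_meet f e1 e2 : affine f -> meet e1 e2 ->
  exists2 st : R * R, (0 < st.1 < 1) && (0 < st.2 < 1) &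
    along f e1 st.1 = along f e2 st.2.
Proof.
move=> [c fE] [st st01 [xE yE]]; exists st => //.
have fE' e u : along f e u = c.1.1 * along x e u + c.1.2 * along y e u + c.2.
  by rewrite /along !fE /lin /=; ring.
by rewrite !fE' xE yE.
Qed.

Lemma meetC e1 e2 : meet e1 e2 -> meet e2 e1.
Proof. by case=> -[s t] /andP[? ?] [? ?]; exists (t, s) => //; apply/andP. Qed.

Definition swap e := (e.2, e.1).

Lemma alongC f e t : along f (swap e) t = along f e (1 - t).
Proof. by rewrite /along /=; ring. Qed.

Lemma between_swap p e : between p (swap e) -> between p e.
Proof.
move=> [t t01 [xE yE]]; exists (1 - t); first by lra.
by rewrite xE yE !alongC.
Qed.

Lemma meet_swap e1 e2 : meet (swap e1) (swap e2) -> meet e1 e2.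
Proof.
move=> [[s t] /= st01 [xE yE]]; exists (1 - s, 1 - t) => /=; first by lra.
by rewrite -!alongC.
Qed.

Lemma between_neq a b p : a != b -> between p (a, b) -> p != a /\ p != b.
Proof.
move=> ab [t t01 []]; rewrite /along /= => xE yE.
by split; apply: contra_neq ab => pE; subst p; apply: xy_inj; nra.
Qed.

Lemma along_ge0 f e t : 0 < t < 1 -> 0 <= f e.1 -> 0 <= f e.2 ->
  0 <= along f e t.
Proof. by move=> t01 f1 f2; rewrite /along; nra. Qed.

Lemma along_le0_eq0 f e t : 0 < t < 1 -> 0 <= f e.1 -> 0 <= f e.2 ->
  along f e t <= 0 -> f e.1 = 0 /\ f e.2 = 0.
Proof. by move=> t01 f1 f2; rewrite /along => le; split; nra. Qed.

Lemma alongN f e t : along (fun p => - f p) e t = - along f e t.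
Proof. by rewrite /along; ring. Qed.

Lemma affine_opp f : affine f -> affine (fun p => - f p).
Proof.
move=> [c fE]; exists (- c.1.1, - c.1.2, - c.2) => p.
by rewrite fE /lin /=; ring.
Qed.

(** * Noncrossing bipartite drawings: two ways of enlarging them *)

Definition plane_bigraph A B E :=
  [/\ E \subset setX A B,
      forall e p, e \in E -> p \in A :|: B -> ~ between p e &
      forall e1 e2, e1 \in E -> e2 \in E -> meet e1 e2 -> e1 = e2].

Lemma plane_bigraph_swap A B E : plane_bigraph A B E ->
  plane_bigraph B A (swap @: E).
Proof.
move=> [/subsetP EAB vis nc]; split.
- apply/subsetP => _ /imsetP[[a b] /EAB + ->].
  by rewrite !inE /= andbC.
- move=> _ p /imsetP[e eE ->]; rewrite setUC => pAB /between_swap.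
  exact: vis.
- move=> _ _ /imsetP[e1 e1E ->] /imsetP[e2 e2E ->] /meet_swap m.
  by rewrite (nc _ _ e1E e2E m).
Qed.

Lemma card_swap E : #|swap @: E| = #|E|.
Proof. by rewrite card_imset // => -[? ?] [? ?] [-> ->]. Qed.

(* The two halves may only share the edge [(a, b)] of the dividing line: any
   other bichromatic pair of that line has [b] in between. *)
Lemma plane_bigraph_glue A1 B1 A2 B2 E1 E2 l a b :
    affine l ->
    {in A1 :|: B1, forall p, 0 <= l p} -> {in A2 :|: B2, forall p, l p <= 0} ->
    {in A1 :|: A2 & B1 :|: B2, forall a' b', l a' = 0 -> l b' = 0 ->
       a' = a /\ (b' = b \/ between b (a, b'))} ->
    {in (A1 :|: A2) :|: (B1 :|: B2), forall p, ~ between p (a, b)} ->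
    b \in B1 -> b \in B2 ->
    plane_bigraph A1 B1 E1 -> plane_bigraph A2 B2 E2 ->
  plane_bigraph (A1 :|: A2) (B1 :|: B2) (E1 :|: E2) /\ (#|E1 :&: E2| <= 1)%N.
Proof.
move=> afl l1 l2 line vab bB1 bB2 [/subsetP s1 v1 n1] [/subsetP s2 v2 n2].
have z1 e : e \in E1 -> l e.1 = 0 -> l e.2 = 0 -> e = (a, b).
  case: e => a' b' eE /= la lb; have /= := s1 _ eE.
  rewrite inE /= => /andP[aA bB].
  have [||aE bE] := line a' b' _ _ la lb; rewrite ?inE ?aA ?bB //.
  case: bE => [->|bb]; first by rewrite aE.
  by case: (v1 _ b eE); rewrite ?inE ?bB1 ?orbT // aE.
have z2 e : e \in E2 -> l e.1 = 0 -> l e.2 = 0 -> e = (a, b).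
  case: e => a' b' eE /= la lb; have /= := s2 _ eE.
  rewrite inE /= => /andP[aA bB].
  have [||aE bE] := line a' b' _ _ la lb; rewrite ?inE ?aA ?bB ?orbT //.
  case: bE => [->|bb]; first by rewrite aE.
  by case: (v2 _ b eE); rewrite ?inE ?bB2 ?orbT // aE.
have e1P e : e \in E1 -> 0 <= l e.1 /\ 0 <= l e.2.
  move=> /s1; rewrite inE => /andP[? ?].
  by split; apply: l1; rewrite inE; apply/orP; [left|right].
have e2P e : e \in E2 -> l e.1 <= 0 /\ l e.2 <= 0.
  move=> /s2; rewrite inE => /andP[? ?].
  by split; apply: l2; rewrite inE; apply/orP; [left|right].
(* Edges of [E1] have both ends where [l >= 0]. An interior point with [l <= 0] thus forces both
   ends onto the line, where [(a, b)] is the only edge. The next claim is the mirror image for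
   [E2]. *)
have p1 e t : e \in E1 -> 0 < t < 1 -> along l e t <= 0 -> e = (a, b).
  move=> eE t01 le; have [g1 g2] := e1P _ eE.
  by have [] := along_le0_eq0 t01 g1 g2 le; apply: z1.
have p2 e t : e \in E2 -> 0 < t < 1 -> 0 <= along l e t -> e = (a, b).
  move=> eE t01 le; have [g1 g2] := e2P _ eE.
  have [||||/eqP + /eqP] := @along_le0_eq0 (fun p => - l p) e t;
    rewrite ?alongN ?oppr_ge0 ?oppr_le0 ?oppr_eq0 //.
  by move=> /eqP + /eqP; apply: z2.
have n12 e1 e2 : e1 \in E1 -> e2 \in E2 -> meet e1 e2 -> e1 = e2.
  move=> e1E e2E /(affine_meet afl)[[s t] /andP[/= s01 t01] st].
  have [? ?] := e1P _ e1E; have [? ?] := e2P _ e2E.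
  have -> : e2 = (a, b) by apply: (p2 _ t) => //; rewrite -st along_ge0.
  by apply: (p1 _ s) => //; rewrite st -oppr_ge0 -alongN along_ge0 ?oppr_ge0.
split; [split|].
- apply/subsetP => e; rewrite !inE.
  by case/orP => [/s1|/s2]; rewrite inE => /andP[-> ->]; rewrite ?orbT.
- move=> e p eE pAB pe; have [t t01 lp] := affine_between afl pe.
  have pv : e = (a, b) -> False by move=> ee; apply: (vab p pAB); rewrite -ee.
  have pE : p \in A1 :|: B1 \/ p \in A2 :|: B2.
    by move: pAB; rewrite !inE -!orbA; do ![case/orP => [->|]];
       rewrite ?orbT; auto; move=> ->; rewrite orbT; right.
  case/setUP: eE => eE; case: pE => pE.
  + exact: (v1 e p).
  + by apply/pv/(p1 _ t) => //; rewrite -lp l2.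
  + by apply/pv/(p2 _ t) => //; rewrite -lp l1.
  + exact: (v2 e p).
- move=> e1 e2 /setUP[]e1E /setUP[]e2E m; try by [apply: n1|apply: n2|apply: n12].
  by apply/esym/n12 => //; apply: meetC.
- rewrite -(cards1 (a, b)); apply/subset_leq_card/subsetP => e /setIP[e1E e2E].
  have [g1 g2] := e1P _ e1E; have [k1 k2] := e2P _ e2E.
  by rewrite inE; apply/eqP/z1 => //; apply/eqP; rewrite eq_le ?g1 ?g2 ?k1 ?k2.
Qed.

(* All other points lie in the half-plane [h >= 0], which contains neither [a]
   nor [b], so that an edge from [a] or [b] to the point [z] of its boundary
   meets no other edge. *)
Lemma plane_bigraph_add_pair A B E a b z h l :
    affine h -> affine l -> a \in A -> b \in B -> a != b ->
    h a < 0 -> h b < 0 -> {in (A :\ a) :|: (B :\ b), forall p, 0 <= h p} ->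
    z \in (A :\ a) :|: (B :\ b) -> h z = 0 ->
    l a = 0 -> l b = 0 -> l z != 0 ->
    plane_bigraph (A :\ a) (B :\ b) E ->
  exists2 E', plane_bigraph A B E' & #|E'| = #|E|.+2.
Proof.
move=> afh afl aA bB ab ha hb h0 zAB hz la lb lz [/subsetP s v n].
(* The second new edge joins [z] to whichever of [a] and [b] has the other colour. *)
pose w : T * T := if z \in A :\ a then (z, b) else (a, z).
have wE : exists2 c, c \in [:: a; b] & w = (z, c) \/ w = (c, z).
  by rewrite /w; case: ifP => _; [exists b|exists a]; rewrite ?inE ?eqxx ?orbT; auto.
have za : z != a by apply: contra_neq lz => ->.
have zb : z != b by apply: contra_neq lz => ->.
have wAB : w \in setX A B.
  rewrite /w; case: ifP => [/setD1P[_ zA]|zA]; first by rewrite inE /= zA.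
  by move: zAB; rewrite in_setU zA => /setD1P[_ zB]; rewrite inE /= aA.
have EP e : e \in E -> [/\ e.1 \in A :\ a, e.2 \in B :\ b, 0 <= h e.1 & 0 <= h e.2].
  move=> /s; rewrite inE => /andP[? ?]; split => //; apply: h0; rewrite inE.
    by apply/orP; left.
  by apply/orP; right.
have abE : (a, b) \notin E by apply/negP => /EP[/=]; rewrite !inE eqxx.
have wNE : w \notin E.
  apply/negP => /EP[]; rewrite /w; case: ifP => _ /=; rewrite !inE eqxx //.
have abw : (a, b) != w.
  rewrite /w; case: ifP => _; apply/negP => /eqP[] /esym/eqP.
    by rewrite (negPf za).
  by rewrite (negPf zb).
(* Both new edges have [h < 0] in their interior and all old ones have [h >= 0], so [h] rules out
   crossings of new with old edges. The form [l] then tells the two new edges apart: it vanishes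
   along [(a, b)] and nowhere inside [w]. *)
have hw t : 0 < t < 1 -> along h w t < 0.
  move=> t01; have [c] := wE; rewrite !inE => cab wc.
  have hc : h c < 0 by case/orP: cab => /eqP->.
  by rewrite /along; case: wc => -> /=; rewrite hz; nra.
have lw t : 0 < t < 1 -> along l w t != 0.
  move=> t01; have [c] := wE; rewrite !inE => cab wc.
  have lc : l c = 0 by case/orP: cab => /eqP->.
  rewrite /along; case: wc => -> /=; rewrite lc mulr0 ?addr0 ?add0r mulf_neq0 //.
    by rewrite lt0r_neq0 //; lra.
  by rewrite lt0r_neq0 //; lra.
have hab t : 0 < t < 1 -> along h (a, b) t < 0 by rewrite /along /=; nra.
have lab t : along l (a, b) t = 0 by rewrite /along la lb /=; ring.
have hE e t : e \in E -> 0 < t < 1 -> 0 <= along h e t.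
  by move=> /EP[_ _ ? ?] t01; apply: along_ge0.
have ABP p : p \in A :|: B -> [\/ p = a, p = b | 0 <= h p].
  rewrite inE => pAB; have [->|pa] := eqVneq p a; first by constructor 1.
  have [->|pb] := eqVneq p b; first by constructor 2.
  by constructor 3; apply: h0; rewrite !inE pa pb.
have nab e : e \in E -> ~ meet (a, b) e.
  move=> eE /(affine_meet afh)[[s0 t] /andP[/= s01 t01] st].
  by move: (hab _ s01); rewrite st ltNge hE.
have nw e : e \in E -> ~ meet w e.
  move=> eE /(affine_meet afh)[[s0 t] /andP[/= s01 t01] st].
  by move: (hw _ s01); rewrite st ltNge hE.
have nabw : ~ meet (a, b) w.
  move=> /(affine_meet afl)[[s0 t] /andP[/= s01 t01] st].
  by move: (lw _ t01); rewrite -st lab eqxx.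
exists ((a, b) |: (w |: E)); last by rewrite !cardsU1 wNE !inE (negPf abw) abE.
split.
- apply/subsetP => e; rewrite !inE => /or3P[/eqP->|/eqP->|/EP[]].
  + by rewrite /= aA.
  + by move: wAB; rewrite inE.
  + by rewrite !inE => /andP[_ ->] /andP[_ ->].
- move=> e p; rewrite !inE -in_setU => /or3P[/eqP->|/eqP->|eE] pAB pe.
  + have [t t01 hp] := affine_between afh pe.
    have [pa|pb|] := ABP p pAB;
      try by have := between_neq ab pe; rewrite ?pa ?pb eqxx; case.
    by rewrite hp leNgt hab.
  + have [t t01 hp] := affine_between afh pe.
    have [t' t'01 lp] := affine_between afl pe.
    have [pa|pb|] := ABP p pAB; last by rewrite hp leNgt hw.
    * by move: (lw _ t'01); rewrite -lp pa la eqxx.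
    * by move: (lw _ t'01); rewrite -lp pb lb eqxx.
  + have [t t01 hp] := affine_between afh pe.
    apply: (v _ _ eE _ pe); move: pAB; rewrite !inE.
    have [pa|_] := eqVneq p a; first by move: (hE _ _ eE t01); rewrite -hp pa leNgt ha.
    have [pb|_] := eqVneq p b; first by move: (hE _ _ eE t01); rewrite -hp pb leNgt hb.
    by [].
- move=> e1 e2; rewrite !inE.
  move=> /or3P[/eqP->|/eqP->|e1E] /or3P[/eqP->|/eqP->|e2E] m //.
  + by case: (nab _ e2E).
  + by case: nabw; apply: meetC.
  + by case: (nw _ e2E).
  + by case: (nab _ e1E); apply: meetC.
  + by case: (nw _ e1E); apply: meetC.
  + exact: n.
Qed.

(** Only lines through both colours are bounded: in the application such a line also carries a
    blocker outside [A] and [B], which uses up one of the four collinear points. *)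
Definition few_collinear A B := forall c : R * R * R, (c.1.1 != 0) || (c.1.2 != 0) ->
  forall a b, a \in A -> b \in B -> lin c a = 0 -> lin c b = 0 ->
  (#|[set p in A :|: B | (lin c p == 0)%R]| <= 3)%N.

Lemma few_collinearS A B A' B' : A' \subset A -> B' \subset B ->
  few_collinear A B -> few_collinear A' B'.
Proof.
move=> sA sB few c c0 a b aA bB la lb.
apply: leq_trans (few c c0 a b _ _ la lb);
  [|exact: (subsetP sA)|exact: (subsetP sB)].
apply/subset_leq_card/subsetP => p; rewrite !inE => /andP[/orP[]pA ->].
  by rewrite (subsetP sA).
by rewrite (subsetP sB) ?orbT.
Qed.

Lemma few_collinearC A B : few_collinear A B -> few_collinear B A.
Proof. by move=> few c c0 a b aB bA la lb; rewrite setUC; apply: few lb la. Qed.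

(** For [n] points of each colour this asks for [2n - 1] edges, written without subtraction. *)
Definition large_bigraph A B :=
  exists2 E, plane_bigraph A B E & (#|A| + #|B| <= #|E|.+1)%N.

Lemma large_bigraphC A B : large_bigraph A B -> large_bigraph B A.
Proof.
move=> [E /plane_bigraph_swap pE cE]; exists (swap @: E) => //.
by rewrite card_swap addnC.
Qed.

Lemma ex_min (D : {set T}) f i0 : i0 \in D ->
  exists2 i, i \in D & {in D, forall j, f i <= f j}.
Proof.
by move=> i0D; case: (Order.TotalTheory.arg_minP f i0D) => i iD im; exists i.
Qed.

(** * The induction step: sweeping a ray around a farthest point [a0] *)

Section Pivot.
Variables (A B : {set T}) (a0 : T).
Hypotheses (a0A : a0 \in A) (dAB : [disjoint A & B]) (few : few_collinear A B).
Hypothesis far : {in A :|: B, forall p,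
  x p ^+ 2 + y p ^+ 2 <= x a0 ^+ 2 + y a0 ^+ 2}.
Hypotheses (cAB : #|A| = #|B|) (A_gt1 : (1 < #|A|)%N).
Hypothesis IH : forall A' B' : {set T}, A' \subset A -> B' \subset B ->
  #|A'| = #|B'| -> (0 < #|A'| < #|A|)%N -> large_bigraph A' B'.

Let D := (A :\ a0) :|: B.
(* [H p / |a0|] is the distance of [p] to the line through [a0] orthogonal to
   the position vector of [a0], and [key p] is the slope of [p] seen from [a0]. *)
Let H p := x a0 ^+ 2 + y a0 ^+ 2 - (x a0 * x p + y a0 * y p).
Let C p := x a0 * y p - y a0 * x p.
Let key p := C p / H p.
Let l q p := C p - key q * H p.

Let affH : affine H.
Proof. by exists (- x a0, - y a0, x a0 ^+ 2 + y a0 ^+ 2) => p; rewrite /H /lin /=; ring. Qed.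

Let linl q : exists2 c,
  (c.1.1 = - y a0 + key q * x a0) /\ (c.1.2 = x a0 + key q * y a0) &
  l q =1 lin c.
Proof.
exists (- y a0 + key q * x a0, x a0 + key q * y a0,
        - key q * (x a0 ^+ 2 + y a0 ^+ 2)) => //.
by move=> p; rewrite /l /C /H /lin /=; ring.
Qed.

Let affl q : affine (l q).
Proof. by have [c _ cE] := linl q; exists c. Qed.

Let a0B : a0 \notin B.
Proof. by rewrite (disjointFr dAB a0A). Qed.

Let DP p : (p \in D) = (p != a0) && (p \in A :|: B).
Proof. by rewrite !inE; case: eqVneq => [->|//]; rewrite (negPf a0B). Qed.

Let H0 : H a0 = 0. Proof. by rewrite /H; ring. Qed.
Let C0 : C a0 = 0. Proof. by rewrite /C; ring. Qed.
Let l0 q : l q a0 = 0. Proof. by rewrite /l C0 H0; ring. Qed.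

(** As [p != a0] and [|p| <= |a0|], expanding [|p - a0|^2 > 0] gives [a0 . p < |a0|^2]. All other
    points thus lie strictly on one side of a line through [a0], which makes [key] a faithful
    angular order. *)
Let H_gt0 p : p \in D -> 0 < H p.
Proof.
rewrite DP => /andP[pa /far pf]; rewrite /H.
have [d0|d0] := eqVneq ((x p - x a0) ^+ 2 + (y p - y a0) ^+ 2) 0; last first.
  have : 0 < (x p - x a0) ^+ 2 + (y p - y a0) ^+ 2.
    by rewrite lt_def d0 addr_ge0 ?sqr_ge0.
  by rewrite !sqrrB => ?; lra.
move: d0 => /eqP; rewrite paddr_eq0 ?sqr_ge0 // !sqrf_eq0 !subr_eq0.
by case/andP => /eqP xE /eqP yE; rewrite (xy_inj xE yE) eqxx in pa.
Qed.

Let lE q p : p \in D -> l q p = H p * (key p - key q).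
Proof.
move=> /H_gt0/lt0r_neq0 Hp; rewrite mulrBr {1}/key mulrC divfK //.
by rewrite /l [key q * _]mulrC.
Qed.

Let l_gt0 q p : p \in D -> (0 < l q p) = (key q < key p).
Proof. by move=> pD; rewrite lE // pmulr_rgt0 ?H_gt0 // subr_gt0. Qed.

Let l_lt0 q p : p \in D -> (l q p < 0) = (key p < key q).
Proof. by move=> pD; rewrite lE // pmulr_rlt0 ?H_gt0 // subr_lt0. Qed.

Let l_eq0 q p : p \in D -> (l q p == 0) = (key p == key q).
Proof.
by move=> pD; rewrite lE // mulf_eq0 (negPf (lt0r_neq0 (H_gt0 pD))) subr_eq0.
Qed.

(** If [a0] were the origin, [H] would vanish identically, against its positivity on [B]. *)
Let a0_neq0 : x a0 ^+ 2 + y a0 ^+ 2 != 0.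
Proof.
have /card_gt0P[p pB] : (0 < #|B|)%N by rewrite -cAB; apply: ltnW.
have : 0 < H p by apply: H_gt0; rewrite inE pB orbT.
apply: contraTneq => /eqP; rewrite paddr_eq0 ?sqr_ge0 // !sqrf_eq0.
by case/andP=> /eqP xE /eqP yE; rewrite /H xE yE -leNgt; lra.
Qed.

(** Up to a constant and a sign, [H] and [C] are the inner and cross products with [a0]. They form
    an affine coordinate system, the linear part having determinant [|a0|^2] up to sign. *)
Let eq_HC p e t : H p = along H e t -> C p = along C e t ->
  x p = along x e t /\ y p = along y e t.
Proof.
set u := along x e t; set v := along y e t => HE CE.
have hE : x a0 * (x p - u) + y a0 * (y p - v) = 0.
  by move: HE; rewrite /u /v /along /H => HE; lra.
have cE : x a0 * (y p - v) - y a0 * (x p - u) = 0.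
  by move: CE; rewrite /u /v /along /C => CE; lra.
split; apply/eqP; rewrite -subr_eq0 -(mulrI_eq0 _ (lregP a0_neq0)); apply/eqP.
  transitivity (x a0 * (x a0 * (x p - u) + y a0 * (y p - v)) -
    y a0 * (x a0 * (y p - v) - y a0 * (x p - u))).
    by ring.
  by rewrite hE cE; ring.
transitivity (y a0 * (x a0 * (x p - u) + y a0 * (y p - v)) +
  x a0 * (x a0 * (y p - v) - y a0 * (x p - u))).
  by ring.
by rewrite hE cE; ring.
Qed.

(** * Drawings obtained from a ray at [a0] whose points all lie in [B] *)

Section Ray.
Variables (q b : T).

Let LA := [set p in A :\ a0 | key p < key q].
Let RA := [set p in A :\ a0 | key q < key p].
Let LB := [set p in B | key p < key q].
Let RB := [set p in B | key q < key p].
Let GB := [set p in B | key p == key q].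

Hypothesis GA0 : forall p, p \in A :\ a0 -> key p != key q.
Hypotheses (bG : b \in GB) (bmin : {in GB, forall p, H b <= H p}).

Let bB : b \in B. Proof. by move: bG; rewrite inE => /andP[]. Qed.
Let BD p : p \in B -> p \in D. Proof. by rewrite inE => ->; rewrite orbT. Qed.
Let AD p : p \in A :\ a0 -> p \in D. Proof. by move=> pA; rewrite inE pA. Qed.

(** On the ray [C = key q * H], so [H] alone locates a point, and [b] divides the segment from [a0]
    to [p] at parameter [H b / H p]. *)
Let near p : p \in GB -> p = b \/ between b (a0, p).
Proof.
move=> pG; have := bmin pG; move: bG pG; rewrite !inE.
move=> /andP[_ /eqP kb] /andP[pB /eqP kp] Hbp.
have Hp := H_gt0 (BD pB); have Hb := H_gt0 (BD bB).
have CE r : r \in B -> key r = key q -> C r = key q * H r.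
  by move=> rB <-; rewrite /key divfK // lt0r_neq0 // H_gt0 // BD.
have Hpb : H b = along H (a0, p) (H b / H p).
  by rewrite /along /= H0 mulr0 add0r divfK ?lt0r_neq0.
have Cpb : C b = along C (a0, p) (H b / H p).
  by rewrite /along /= C0 mulr0 add0r !CE // mulrCA divfK ?lt0r_neq0.
have [xE yE] := eq_HC Hpb Cpb.
have [Hlt|Hge] := ltP (H b) (H p).
  by right; exists (H b / H p) => //; rewrite divr_gt0 //= ltr_pdivrMr ?mul1r.
have H1 : H b / H p = 1.
  by rewrite (le_anti (introT andP (conj Hbp Hge))) divff ?lt0r_neq0.
left; apply: xy_inj; rewrite ?xE ?yE H1 /along /=; ring.
Qed.

Let visb p : p \in A :|: B -> ~ between p (a0, b).
Proof.
move=> pAB pab; have [t t01 Hp] := affine_between affH pab.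
have [t' t'01] := affine_between (affl q) pab.
have Hb := H_gt0 (BD bB).
have lb : l q b = 0 by apply/eqP; rewrite l_eq0 ?BD //; move: bG; rewrite inE => /andP[].
rewrite /along /= l0 lb !mulr0 addr0 => /eqP lp.
move: Hp; rewrite /along /= H0 mulr0 add0r => Hp.
have [pE|pa] := eqVneq p a0; first by move: Hp; rewrite pE H0; nra.
have pD : p \in D by rewrite DP pa.
move: lp; rewrite l_eq0 // => kp; move: pAB; rewrite inE => /orP[pA|pB].
  by have := @GA0 p; rewrite !inE pa pA kp => /(_ isT).
have /bmin : p \in GB by rewrite inE pB.
by rewrite Hp; nra.
Qed.

Let l_ge0 p : p \in D -> (0 <= l q p) = (key q <= key p).
Proof. by move=> pD; rewrite leNgt l_lt0 // -leNgt. Qed.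

Let l_le0 p : p \in D -> (l q p <= 0) = (key p <= key q).
Proof. by move=> pD; rewrite leNgt l_gt0 // -leNgt. Qed.

Let cards_A : #|A| = (#|LA| + #|RA|).+1.
Proof.
rewrite (cardsD1 a0) a0A add1n; congr _.+1.
rewrite -(cardsID [set p | key p < key q] (A :\ a0)); congr (_ + _)%N.
  by apply: eq_card => p; rewrite !inE.
apply: eq_card => p; rewrite !inE -leNgt andbC; apply: andb_id2l => pA.
by rewrite lt_neqAle eq_sym GA0 ?inE.
Qed.

(** [S1] and [S2] say which points of the ray join which side; both receive [b]. Each side gets a
    balanced drawing by induction, with at least [2 #|RA| + 1] and [2 #|LA| + 1] edges. One edge may
    be shared, and [2 #|A| - 1] remain. A nonempty [LA] makes the right side smaller than [A], and
    conversely. *)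
Lemma split_ray (S1 S2 : {set T}) : b \in S1 -> b \in S2 -> S1 :|: S2 = GB ->
  (#|RA|.+1 = #|S1| + #|RB|)%N -> (#|LA|.+1 = #|S2| + #|LB|)%N ->
  LA != set0 -> RA != set0 -> large_bigraph A B.
Proof.
move=> b1 b2 S12 c1 c2; rewrite -!card_gt0 => LA0 RA0.
have S1G p : p \in S1 -> p \in GB by rewrite -S12 inE => ->.
have S2G p : p \in S2 -> p \in GB by rewrite -S12 inE => ->; rewrite orbT.
have GBE p : p \in GB -> p \in B /\ key p = key q.
  by rewrite inE => /andP[? /eqP].
have a0N (p : pred T) : a0 \notin [set x in A :\ a0 | p x] by rewrite !inE eqxx.
have d1 : #|S1 :|: RB| = (#|S1| + #|RB|)%N.
  apply/eqP; rewrite leq_card_setU disjoint_subset.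
  by apply/subsetP => p /S1G/GBE[pB kp]; rewrite !inE pB kp ltxx.
have d2 : #|S2 :|: LB| = (#|S2| + #|LB|)%N.
  apply/eqP; rewrite leq_card_setU disjoint_subset.
  by apply/subsetP => p /S2G/GBE[pB kp]; rewrite !inE pB kp ltxx.
have cA1 : #|a0 |: RA| = #|RA|.+1 by rewrite cardsU1 a0N.
have cA2 : #|a0 |: LA| = #|LA|.+1 by rewrite cardsU1 a0N.
have [E1 g1 e1] : large_bigraph (a0 |: RA) (S1 :|: RB).
  apply: IH; last by rewrite cA1 cards_A; clear -LA0 RA0; lia.
  - by apply/subsetP => p; rewrite !inE => /orP[/eqP->|/andP[/andP[]]].
  - apply/subsetP => p; rewrite inE => /orP[/S1G/GBE[]//|].
    by rewrite inE => /andP[].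
  - by rewrite cA1 d1.
have [E2 g2 e2] : large_bigraph (a0 |: LA) (S2 :|: LB).
  apply: IH; last by rewrite cA2 cards_A; clear -LA0 RA0; lia.
  - by apply/subsetP => p; rewrite !inE => /orP[/eqP->|/andP[/andP[]]].
  - apply/subsetP => p; rewrite inE => /orP[/S2G/GBE[]//|].
    by rewrite inE => /andP[].
  - by rewrite cA2 d2.
have AE : (a0 |: RA) :|: (a0 |: LA) = A.
  apply/setP => p; rewrite !inE; have [->|pa] := eqVneq p a0; first by rewrite a0A.
  rewrite -andb_orr; case pA : (p \in A) => //=.
  have := @GA0 p; rewrite !inE pa pA => /(_ isT).
  by rewrite neq_lt orbC.
have BE : (S1 :|: RB) :|: (S2 :|: LB) = B.
  apply/setP => p; rewrite setUACA S12 !inE; case pB : (p \in B) => //=.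
  by case: ltgtP.
have [] := @plane_bigraph_glue _ _ _ _ E1 E2 (l q) a0 b (affl q) _ _ _ _ _ _ g1 g2;
  rewrite ?AE ?BE ?inE ?b1 ?b2 //.
- move=> p; rewrite !inE.
  case/orP=> [/orP[/eqP->|/andP[pA kp]]|/orP[/S1G/GBE[pB kp]|/andP[pB kp]]].
  + by rewrite l0.
  + by rewrite l_ge0 ?AD ?ltW ?inE.
  + by rewrite l_ge0 ?BD ?kp.
  + by rewrite l_ge0 ?BD ?ltW.
- move=> p; rewrite !inE.
  case/orP=> [/orP[/eqP->|/andP[pA kp]]|/orP[/S2G/GBE[pB kp]|/andP[pB kp]]].
  + by rewrite l0.
  + by rewrite l_le0 ?AD ?ltW ?inE.
  + by rewrite l_le0 ?BD ?kp.
  + by rewrite l_le0 ?BD ?ltW.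
- move=> a' b' aA' bB' /eqP la /eqP lb; split.
    apply/eqP; apply: contraT => aa; have aD : a' \in A :\ a0 by rewrite !inE aa.
    by move: la; rewrite l_eq0 ?AD // (negPf (GA0 aD)).
  by apply: near; rewrite inE bB' -l_eq0 ?BD.
- move=> gAB gi; exists (E1 :|: E2) => //.
  have := cardsUI E1 E2; rewrite cA1 d1 in e1; rewrite cA2 d2 in e2.
  by rewrite -cAB cards_A; clear -c1 c2 e1 e2 gi; lia.
Qed.

(** The form [f], which will be [l q] or its opposite, witnesses that the ray lies on the hull.
    Removing [a0] and [b] leaves at least [2 #|A| - 3] edges by induction, and it remains to find
    the half-plane [h >= 0] for two more. *)
Lemma hull_ray f : affine f -> f a0 = 0 -> {in GB, forall p, f p = 0} ->
  {in D, forall p, p \notin GB -> 0 < f p} -> (#|GB| <= 2)%N ->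
  large_bigraph A B.
Proof.
move=> aff f0 fG fp cG.
have a0b : a0 != b by apply: contraNneq a0B => ->.
have cA1 : #|A :\ a0| = #|A|.-1 by rewrite (cardsD1 a0 A) a0A.
have cB1 : #|B :\ b| = #|A|.-1 by rewrite cAB (cardsD1 b B) bB.
have UD p : p \in (A :\ a0) :|: (B :\ b) -> p \in D.
  by rewrite !inE => /orP[->|/andP[_ ->]]; rewrite ?orbT.
have UG p : p \in GB -> p \in (A :\ a0) :|: (B :\ b) -> p \in GB :\ b.
  rewrite in_setU => pG /orP[/GA0|/setD1P[pb _]]; last by rewrite inE pG inE pb.
  by move: pG; rewrite inE => /andP[_ ->].
have [p0 p0A] : exists p, p \in A :\ a0 by apply/card_gt0P; rewrite cA1; clear -A_gt1; lia.
have p0G : p0 \notin GB by rewrite inE (negPf (GA0 p0A)) andbF.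
have p0U : p0 \in (A :\ a0) :|: (B :\ b) by rewrite inE p0A.
have [E gE cE] : large_bigraph (A :\ a0) (B :\ b).
  apply: IH (subD1set _ _) (subD1set _ _) _ _; rewrite cA1 ?cB1 //.
  by case: #|A| A_gt1 => [|[|n]] //= _; apply: ltnSn.
suff [h [z [affh /andP[ha hb] h_ge0 /andP[zU zG] hz]]] : exists h z,
    [/\ affine h, (h a0 < 0) && (h b < 0),
        {in (A :\ a0) :|: (B :\ b), forall p, 0 <= h p},
        (z \in (A :\ a0) :|: (B :\ b)) && (z \notin GB) & h z = 0].
  have [|E' gE' cE'] := plane_bigraph_add_pair affh aff a0A bB a0b ha hb
    h_ge0 zU hz f0 (fG _ bG) _ gE.
    by rewrite lt0r_neq0 // fp // UD.
  by exists E' => //; rewrite -cAB cE'; move: cE; rewrite cA1 cB1; clear -A_gt1; lia.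
(* If [b] is alone on the ray, the boundary of the half-plane is parallel to the line [f = 0],
   through a remaining point [z] nearest to that line. *)
have [GE|] := eqVneq (GB :\ b) set0.
  have [z zU zmin] := ex_min f p0U.
  have zG : z \notin GB by apply/negP => zG; have := UG _ zG zU; rewrite GE inE.
  have fz := fp _ (UD _ zU) zG.
  exists (fun p => f p - f z), z.
  split; rewrite ?zU ?zG ?subrr ?f0 ?(fG _ bG) ?sub0r ?oppr_lt0 ?fz //.
    case: aff => c cE'; exists (c.1, c.2 - f z) => p; rewrite cE' /lin /=; ring.
  by move=> p pU; rewrite subr_ge0 zmin.
case/set0Pn => b' b'G.
have GE : GB :\ b = [set b'].
  apply/esym/eqP; rewrite eqEcard sub1set b'G cards1 /=.
  by move: cG; rewrite (cardsD1 b GB) bG; clear; lia.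
move: b'G => /setD1P[b'b b'G].
(* The half-plane is bounded by the line through [b'] that makes the
   smallest angle with [a0 b b'] among those through another point. *)
have p0U' : p0 \in ((A :\ a0) :|: (B :\ b)) :\: GB by rewrite inE p0G.
have [z] := ex_min (fun p => (H p - H b') / f p) p0U'.
rewrite inE => /andP[zG zU] zmin; have fz := fp _ (UD _ zU) zG.
pose r := (H z - H b') / f z.
have b'B : b' \in B by move: b'G; rewrite inE => /andP[].
exists (fun p => H p - H b' - r * f p), z; split.
- case: affH => c cH; case: aff => d dF.
  exists (c.1.1 - r * d.1.1, c.1.2 - r * d.1.2, c.2 - H b' - r * d.2) => p.
  by rewrite cH dF /lin /=; ring.
(* At [a0] the form equals [- H b']. At [b] it equals [H b - H b'], which is negative because [b]
   lies strictly between [a0] and [b']. *)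
- rewrite f0 H0 mulr0 subr0 sub0r oppr_lt0 H_gt0 ?BD //=.
  rewrite (fG _ bG) mulr0 subr0 subr_lt0 lt_def bmin // andbT.
  apply: contra_neq b'b => Hbb.
  case: (near b'G) => [->//|].
  case/(affine_between affH) => t /andP[_ t1]; rewrite /along /= H0 Hbb.
  rewrite mulr0 add0r => Hb; have : t * H b < H b by rewrite gtr_pMl // H_gt0 // BD.
  by rewrite -Hb ltxx.
- move=> p pU; have [pG|pG] := boolP (p \in GB).
    have := UG _ pG pU; rewrite GE inE => /eqP->.
    by rewrite (fG _ b'G) mulr0 subr0 subrr.
  rewrite subr_ge0 -ler_pdivlMr; last by apply: fp => //; apply: UD.
  by apply: zmin; rewrite inE pG.
- by rewrite zU.
- by rewrite /r divfK ?subrr // lt0r_neq0.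
Qed.

End Ray.

(** The line of the ray contains [a0] of [A] and [b] of [B], hence at most three coloured points;
    discarding [a0] leaves two. *)
Let few_ray q b : b \in B -> key b = key q ->
  (#|[set p in A :\ a0 | key p == key q]| + #|[set p in B | key p == key q]| <= 2)%N.
Proof.
move=> bB kb; have [c [c1 c2] lc] := linl q.
have bD : b \in D by rewrite inE bB orbT.
have c0 : (c.1.1 != 0) || (c.1.2 != 0).
  rewrite -negb_and c1 c2; apply: contra a0_neq0 => /andP[/eqP u /eqP v].
  have -> : x a0 ^+ 2 + y a0 ^+ 2 =
    x a0 * (x a0 + key q * y a0) - y a0 * (- y a0 + key q * x a0) by ring.
  by rewrite u v !mulr0 subr0.
have := few c0 a0A bB; rewrite -!lc l0 => /(_ erefl).
have /eqP-> : l q b == 0 by rewrite l_eq0 // kb.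
move=> /(_ erefl) lt3; rewrite -ltnS; apply: leq_trans lt3.
have dG : [disjoint [set p in A :\ a0 | key p == key q] & [set p in B | key p == key q]].
  rewrite disjoint_subset; apply/subsetP => p; rewrite !inE => /andP[/andP[_ pA] _].
  by rewrite (disjointFr dAB pA).
rewrite -cardsUI (disjoint_setI0 dG) cards0 addn0.
rewrite [leqRHS](cardsD1 a0) !inE a0A -lc l0 eqxx ltnS.
apply/subset_leq_card/subsetP => p pG.
have [pD kp] : p \in D /\ key p == key q.
  by move: pG; rewrite !inE => /orP[]/andP[-> ->]; rewrite ?orbT.
by move: (pD); rewrite DP !inE => /andP[-> ->]; rewrite -lc l_eq0.
Qed.

Lemma pivot_large_bigraph : large_bigraph A B.
Proof.
pose good q := (#|[set p in A :\ a0 | (key p <= key q)%R]| <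
                #|[set p in B | (key p <= key q)%R]|)%N.
have cA1 : #|A| = #|A :\ a0|.+1 by rewrite (cardsD1 a0) a0A.
have /card_gt0P[b0 b0B] : (0 < #|B|)%N by rewrite -cAB; apply: ltnW.
have BD p : p \in B -> p \in D by rewrite inE => ->; rewrite orbT.
have AD p : p \in A :\ a0 -> p \in D by move=> pA; rewrite inE pA.
(* The largest slope is good: up to it lie all of [A :\ a0] and all of [B], which has one point
   more. So a smallest good slope [q] exists. *)
have [q0 q0D q0max] := ex_min (fun p => - key p) (BD _ b0B).
have q0Q : q0 \in [set q in D | good q].
  rewrite inE q0D /good.
  have -> : [set p in A :\ a0 | key p <= key q0] = A :\ a0.
    apply/setP => p; rewrite inE; apply: andb_idr => /AD/q0max.
    by rewrite lerN2.
  have -> : [set p in B | key p <= key q0] = B.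
    apply/setP => p; rewrite inE; apply: andb_idr => /BD/q0max.
    by rewrite lerN2.
  by rewrite -cAB cA1 ltnSn.
have [q] := ex_min key q0Q; rewrite inE => /andP[qD qg] qmin {q0 q0D q0max q0Q}.
pose LA := [set p in A :\ a0 | key p < key q].
pose RA := [set p in A :\ a0 | key q < key p].
pose LB := [set p in B | key p < key q].
pose RB := [set p in B | key q < key p].
pose GA := [set p in A :\ a0 | key p == key q].
pose GB := [set p in B | key p == key q].
(* Otherwise some slopes lie below [key q], and the largest of them would already be good. *)
have Lle : (#|LB| <= #|LA|)%N.
  rewrite leqNgt; apply/negP => Llt.
  have /card_gt0P[p] : (0 < #|LB|)%N by apply: leq_ltn_trans Llt.
  rewrite inE => /andP[pB pq].
  have pL : p \in [set p in D | key p < key q] by rewrite inE BD.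
  have [r] := ex_min (fun p => - key p) pL; rewrite inE => /andP[rD rq] rmax.
  have rE s : s \in D -> (key s <= key r) = (key s < key q).
    move=> sD; apply/idP/idP => [sr|sq]; first exact: le_lt_trans rq.
    by rewrite -lerN2 rmax // inE sD.
  suff /qmin : r \in [set q in D | good q] by rewrite leNgt rq.
  rewrite inE rD /good.
  have -> : [set p in A :\ a0 | key p <= key r] = LA.
    by apply/setP => s; rewrite !inE; apply: andb_id2l => sA; rewrite rE ?AD ?inE.
  have -> // : [set p in B | key p <= key r] = LB.
  by apply/setP => s; rewrite !inE; apply: andb_id2l => sB; rewrite rE ?BD.
have leE (S : {set T}) :
    #|[set p in S | key p <= key q]| =
    (#|[set p in S | (key p < key q)%R]| + #|[set p in S | key p == key q]|)%N.
  rewrite -(cardsID [set p | key p < key q]); congr (_ + _)%N;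
  by apply: eq_card => p; rewrite !inE; case: (p \in S); case: (ltgtP (key p) (key q)).
have gtE (S : {set T}) : #|S| =
    (#|[set p in S | (key p <= key q)%R]| + #|[set p in S | (key q < key p)%R]|)%N.
  rewrite -(cardsID [set p | key p <= key q] S); congr (_ + _)%N;
  by apply: eq_card => p; rewrite !inE; case: (p \in S); case: (ltgtP (key p) (key q)).
move: qg; rewrite /good !leE -/LA -/LB -/GA -/GB => qg.
have /card_gt0P[b1 b1G] : (0 < #|GB|)%N by clear -qg Lle; lia.
have G2 : (#|GA| + #|GB| <= 2)%N.
  by move: b1G; rewrite inE => /andP[b1B /eqP/few_ray]; apply.
(* The partial sum rises from at most 0 to at least 1 on this ray, so [#|GA| < #|GB|]; with at most
   two points in all, [GA] is empty. *)
have GA0 : #|GA| = 0%N by clear -qg Lle G2; lia.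
have GA_neq p : p \in A :\ a0 -> key p != key q.
  move=> pA; apply/negP => kp; have /card_gt0P : exists p, p \in GA.
    by exists p; rewrite inE pA.
  by rewrite GA0.
have [b bG bmin] := ex_min H b1G.
have eA : (#|LA| + #|RA| + 1 = #|A|)%N.
  by rewrite cA1 (gtE (A :\ a0)) leE -/LA -/GA -/RA GA0 addn0 addn1.
have eB : (#|LB| + #|GB| + #|RB| = #|A|)%N.
  by rewrite cAB (gtE B) leE.
have gb1 : b \in [set b] by rewrite inE.
have GB2 : (#|GB| <= 2)%N by clear -G2; lia.
have hullL : LA = set0 -> LB = set0 -> large_bigraph A B.
  move=> LA0 LB0; apply: (hull_ray GA_neq bG bmin (affl q) (l0 q)) GB2.
    move=> p; rewrite inE => /andP[pB kp]; apply/eqP; rewrite l_eq0 //.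
    exact: BD.
  move=> p pD; rewrite inE l_gt0 // => pG; rewrite lt_neqAle leNgt.
  move: (pD); rewrite inE => /orP[pA|pB].
    rewrite eq_sym GA_neq //=; apply/negP => kp.
    have : p \in LA by rewrite in_set pA kp.
    by rewrite LA0 inE.
  rewrite pB /= eq_sym in pG; rewrite pG /=; apply/negP => kp.
  have : p \in LB by rewrite in_set pB kp.
    by rewrite LB0 inE.
have hullR : RA = set0 -> RB = set0 -> large_bigraph A B.
  move=> RA0 RB0.
  apply: (hull_ray GA_neq bG bmin (affine_opp (affl q))) GB2; first by rewrite l0 oppr0.
    move=> p; rewrite inE => /andP[pB kp]; apply/eqP; rewrite oppr_eq0 l_eq0 //.
    exact: BD.
  move=> p pD; rewrite inE oppr_gt0 l_lt0 // => pG; rewrite lt_neqAle leNgt.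
  move: (pD); rewrite inE => /orP[pA|pB].
    rewrite GA_neq //=; apply/negP => kp.
    have : p \in RA by rewrite in_set pA kp.
    by rewrite RA0 inE.
  rewrite pB /= in pG; rewrite pG /=; apply/negP => kp.
  have : p \in RB by rewrite in_set pB kp.
    by rewrite RB0 inE.
have bS : [set b] :|: GB = GB by apply/setUidPr; rewrite sub1set.
have [LA0|LA0] := eqVneq LA set0.
  by apply: hullL => //; apply/eqP; rewrite -cards_eq0 -leqn0 -(cards0 T) -LA0.
(* If [RA] is empty, then [#|LA| = #|A| - 1]. As [q] is good, [LB] and [GB] together have at least
   [#|A|] points, which is all of [B], so [RB] is empty too. *)
have [RA0|RA0] := eqVneq RA set0.
  apply: hullR => //; apply/eqP; rewrite -cards_eq0.
  have : #|RA| = 0%N by rewrite RA0 cards0.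
  by clear -eA eB qg Lle GA0; lia.
have [c1|c2] : #|GB| = 1%N \/ #|GB| = 2%N by clear -GB2 qg Lle; lia.
  have GE : [set b] :|: [set b] = GB.
    by rewrite setUid; apply/eqP; rewrite eqEcard sub1set bG cards1 c1.
  have eR : (#|RA|.+1 = #|[set b]| + #|RB|)%N.
    by rewrite cards1; clear -eA eB qg Lle GA0 c1; lia.
  have eL : (#|LA|.+1 = #|[set b]| + #|LB|)%N.
    by rewrite cards1; clear -eA eB qg Lle GA0 c1; lia.
  exact: (split_ray GA_neq bG bmin gb1 gb1 GE eR eL).
(* With two points on the ray, [b] goes to both sides and the other one to the right if the open
   left part is balanced, to the left if it lacks one point of [B]. *)
have [e|e] : #|LA| = #|LB| \/ #|LA| = #|LB|.+1.
  by clear -qg Lle c2 GA0; lia.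
  have eR : (#|RA|.+1 = #|GB| + #|RB|)%N by clear -eA eB c2 e; lia.
  have eL : (#|LA|.+1 = #|[set b]| + #|LB|)%N by rewrite cards1 e.
  have GE : GB :|: [set b] = GB by rewrite setUC.
  exact: (split_ray GA_neq bG bmin bG gb1 GE eR eL).
have eR : (#|RA|.+1 = #|[set b]| + #|RB|)%N.
  by rewrite cards1; clear -eA eB c2 e; lia.
have eL : (#|LA|.+1 = #|GB| + #|LB|)%N by rewrite e c2.
exact: (split_ray GA_neq bG bmin gb1 bG bS eR eL).
Qed.

End Pivot.

Lemma plane_bigraph1 a b : a != b -> plane_bigraph [set a] [set b] [set (a, b)].
Proof.
move=> ab; split.
- by apply/subsetP => e; rewrite !inE => /eqP->; rewrite /= !eqxx.
- by move=> e p /set1P-> /set2P[]-> /(between_neq ab); rewrite eqxx; case.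
- by move=> e1 e2 /set1P-> /set1P->.
Qed.

(** Induction on the common size. A farthest point of the union serves as pivot; if it belongs to
    [B], the colours are exchanged. *)
Theorem balanced_large_bigraph A B : [disjoint A & B] -> few_collinear A B ->
  #|A| = #|B| -> (0 < #|A|)%N -> large_bigraph A B.
Proof.
have [n] := ubnP #|A|; elim: n A B => // n IHn A B ltAn dAB few cAB A_gt0.
have [A1|A_gt1] : #|A| = 1%N \/ (1 < #|A|)%N.
  by case: #|A| A_gt0 => [|[|m]]; [|left|right].
  have /eqP/cards1P[a aE] := A1.
  have /eqP/cards1P[b bE] : #|B| = 1%N by rewrite -cAB.
  exists [set (a, b)]; rewrite ?aE ?bE ?cards1 //; apply: plane_bigraph1.
  by move: dAB; rewrite aE bE disjoints1 inE.
have IH A' B' : A' \subset A -> B' \subset B -> #|A'| = #|B'| ->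
    (0 < #|A'| < #|A|)%N -> large_bigraph A' B'.
  move=> sA sB c' /andP[A'0 A'A]; apply: IHn => //; first exact: leq_trans A'A _.
    by apply: disjointWl sA _; apply: disjointWr sB _.
  exact: few_collinearS few.
have /card_gt0P[a aA] := A_gt0.
have aAB : a \in A :|: B by rewrite inE aA.
have [a0 + far] := ex_min (fun p => - (x p ^+ 2 + y p ^+ 2)) aAB.
have {}far : {in A :|: B, forall p,
    x p ^+ 2 + y p ^+ 2 <= x a0 ^+ 2 + y a0 ^+ 2}.
  by move=> p /far; rewrite lerN2.
case/setUP => [a0A|a0B]; first exact: pivot_large_bigraph a0A dAB few far cAB A_gt1 IH.
apply: large_bigraphC; apply: (pivot_large_bigraph a0B).
- by rewrite disjoint_sym.
- exact: few_collinearC.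
- by rewrite setUC.
- exact/esym.
- by rewrite -cAB.
- move=> B' A' sB sA c' cB; apply: large_bigraphC; apply: IH => //.
  by rewrite -c' cAB.
Qed.


(** * From noncrossing edges to many blockers *)

Lemma between_trans p q a b :
  between p (a, b) -> between q (p, b) -> between q (a, b).
Proof.
move=> [t t01 [xp yp]] [u u01 []]; rewrite /along /= xp yp /along /= => xq yq.
by exists (t + u - u * t); [nra|rewrite xq yq /along /=; split; ring].
Qed.

Lemma between_swapE p a b : between p (a, b) -> between p (b, a).
Proof. exact: (@between_swap p (b, a)). Qed.

(** A blocker outside [S] is coloured, and replacing the end of its colour by it gives a shorter
    bichromatic segment. The number of points strictly inside drops, since the blocker itself is no
    longer among them. *)
Lemma blockers_between A B S : [disjoint A & B] ->
    (forall p, p \notin S -> p \in A :|: B) ->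
    {in A & B, forall a b, exists p, between p (a, b)} ->
  {in A & B, forall a b, exists2 s, s \in S & between s (a, b)}.
Proof.
move=> dAB cover blk a b.
have [n] := ubnP #|[set p : T | `[< between p (a, b) >]]%SET|.
elim: n a b => // n IHn a b; rewrite ltnS => len aA bB.
have [p pab] := blk a b aA bB.
have neq a' b' : a' \in A -> b' \in B -> a' != b'.
  by move=> a'A b'B; apply: contraTneq b'B => <-; rewrite (disjointFr dAB).
have [pS|/cover/setUP[pA|pB]] := boolP (p \in S); first by exists p.
  have [|s sS spb] := IHn p b _ pA bB; last by exists s => //; apply: between_trans spb.
  apply: leq_trans len; apply/proper_card/properP; split.
    by apply/subsetP => q; rewrite !inE => /asboolP/(between_trans pab)/asboolP.
  exists p; rewrite inE; first exact/asboolP.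
  by apply/asboolP => /(between_neq (neq _ _ pA bB)); rewrite eqxx; case.
have trans q : between q (a, p) -> between q (a, b).
  by move=> /between_swapE qa; apply/between_swapE/between_trans/qa/between_swapE.
have [|s sS sap] := IHn a p _ aA pB; last by exists s => //; apply: trans.
apply: leq_trans len; apply/proper_card/properP; split.
  by apply/subsetP => q; rewrite !inE => /asboolP/trans/asboolP.
exists p; rewrite inE; first exact/asboolP.
by apply/asboolP => /(between_neq (neq _ _ aA pB)); rewrite eqxx; case.
Qed.

Lemma card_blockers A B S : [disjoint A & B] -> few_collinear A B ->
    {in A & B, forall a b, exists2 s, s \in S & between s (a, b)} ->
    #|A| = #|B| -> (0 < #|A|)%N ->
  (#|A| + #|B| <= #|S|.+1)%N.
Proof.
move=> dAB few blk cAB A0.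
have [E [/subsetP EAB _ nc] cE] := balanced_large_bigraph dAB few cAB A0.
apply: leq_trans cE _; rewrite ltnS.
pose c e := odflt e.1 [pick s | (s \in S) && `[< between s e >]].
have cP e : e \in E -> c e \in S /\ between (c e) e.
  case: e => a b /EAB; rewrite inE => /andP[/= aA bB].
  rewrite /c; case: pickP => [s /andP[sS /asboolP sab]|/= no] //.
  have [s sS sab] := blk a b aA bB.
  by move: (no s); rewrite sS => /asboolP.
have c_inj : {in E &, injective c}.
  move=> e1 e2 e1E e2E ce; apply: nc => //.
  have [_ [s s01 [xs ys]]] := cP _ e1E; have [_ [t t01 [xt yt]]] := cP _ e2E.
  exists (s, t) => /=; first by rewrite s01 t01.
  by rewrite -xs -ys -xt -yt ce.
rewrite -(card_in_imset c_inj); apply/subset_leq_card/subsetP => _ /imsetP[e eE ->].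
by have [] := cP _ eE.
Qed.

End Plane.

(** * Vertex cuts, degrees and connectivity in a finite graph *)

Section Cut.
Variables (T : finType) (e : rel T).
Hypothesis e_irr : irreflexive e.
Implicit Types (A B S : {set T}).

Lemma min_degree_le v : (min_degree e <= degree e v)%N.
Proof.
rewrite /min_degree; have : v \in index_enum T by rewrite mem_index_enum.
elim: (index_enum T) => // w s IHs; rewrite inE big_cons geq_min.
by case: eqVneq => [->|_ /= /IHs->]; rewrite ?leqnn ?orbT.
Qed.

(** Every neighbour of [v] lies in [A] or [S] and differs from [v], which makes the bound strict. *)
Lemma degree_le_cut A B S v : v \in A ->
    {in A & B, forall a b, ~~ e a b} ->
    (forall p, p \notin S -> p \in A :|: B) ->
  (degree e v < #|A| + #|S|)%N.
Proof.
move=> vA nAB cover; rewrite (cardsD1 v A) vA add1n addSn ltnS.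
apply: leq_trans (leq_card_setU _ _); apply/subset_leq_card/subsetP => w.
rewrite inE => vw; rewrite in_setU.
case: (boolP (w \in S)) => [_|]; first by rewrite orbT.
have wv : w != v by apply: contraTneq vw => ->; rewrite e_irr.
move=> /cover/setUP[wA|wB]; first by rewrite !inE wv wA.
by move: (nAB v w vA wB); rewrite vw.
Qed.

Definition separates A B S := [/\ [disjoint A & B], A != finset.set0, B != finset.set0,
  {in A & B, forall a b, ~~ e a b} & forall p, p \notin S -> p \in A :|: B].

Lemma not_connected_separates S : ~~ connected_on e (~: S) ->
  exists A B, [disjoint S & A :|: B] /\ separates A B S.
Proof.
case/forall_inPn => x xS /forall_inPn[y yS nxy].
set r := (X in connect X) in nxy.
(* One side is the component of [x] outside [S], the other is everything else outside [S]. *)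
pose A := [set z in ~: S | connect r x z]; exists A, (~: S :\: A); split.
  by rewrite disjoint_subset; apply/subsetP => p pS; rewrite !inE pS.
split.
- by rewrite disjoint_subset; apply/subsetP => p; rewrite !inE => ->.
- by apply/set0Pn; exists x; rewrite inE xS connect0.
- by apply/set0Pn; exists y; rewrite !inE -in_setC yS nxy.
- move=> a b; rewrite 2!inE => /andP[aS xa] /setDP[bS]; rewrite inE bS /=.
  apply: contra => ab; apply: connect_trans xa (connect1 _).
  by rewrite /r /= inE aS bS.
- by move=> p pS; rewrite !inE pS; case: connect.
Qed.

(** Fewer than [k] vertices cannot disconnect the graph, as that would yield a separation too small
    for [cut]. The bound [k < #|T|] is part of [k_connected] and also places [k] in the range of the
    maximum. *)
Lemma connectivity_ge k :
    (forall A B S, [disjoint S & A :|: B] -> separates A B S ->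
      (k <= #|S|)%N) ->
    (k < #|T|)%N ->
  (k <= connectivity e)%N.
Proof.
move=> cut kT; rewrite /connectivity.
apply: (@leq_bigmax_cond _ _ (fun i : 'I_#|T| => nat_of_ord i) (Ordinal kT)).
rewrite /k_connected kT /=; apply/forallP => S; apply/implyP => Sk.
apply: contraLR Sk => /not_connected_separates[A [B [dS /(cut _ _ _ dS)]]].
by rewrite -leqNgt.
Qed.

Lemma degree_lt v : (degree e v < #|T|)%N.
Proof.
rewrite -cardsT (cardsD1 v setT) inE add1n ltnS; apply/subset_leq_card/subsetP => w.
by rewrite !inE andbT => vw; apply: contraTneq vw => ->; rewrite e_irr.
Qed.

End Cut.

Lemma exists_subset_card (T : finType) (A : {set T}) n : (n <= #|A|)%N ->
  exists2 A' : {set T}, A' \subset A & #|A'| = n.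
Proof.
case/card_geqP => s [s_uniq <- sA]; exists [set z in s].
  by apply/subsetP => z; rewrite inE => /sA.
by rewrite cardsE; apply/card_uniqP.
Qed.

(** * Application to visibility graphs *)

Section VisibilityCut.
Variables (R : realType) (P : {fset 'rV[R]_2}).
Implicit Types (a b p : P) (A B S : {set P}).

Let x p : R := val p 0 0.
Let y p : R := val p 0 1.
Let e := visibility_graph P.

Let rV2P (u v : 'rV[R]_2) : u 0 0 = v 0 0 -> u 0 1 = v 0 1 -> u = v.
Proof.
move=> u0 u1; apply/rowP => i; case: (unliftP 0 i) => [j|] -> //.
by rewrite (ord1 j) (_ : lift 0 0 = 1) //; apply/val_inj.
Qed.

Let xy_inj p q : x p = x q -> y p = y q -> p = q.
Proof. by move=> xE yE; apply/val_inj/rV2P. Qed.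

Lemma open_segment_between a b p :
  open_segment (val a) (val b) (val p) <-> between x y p (a, b).
Proof.
split=> [[t t01 pE]|[t t01 [xE yE]]]; exists t => //.
  by rewrite /along /x /y pE !mxE.
by apply: rV2P; rewrite !mxE.
Qed.

Lemma visibility_graph_sym : symmetric e.
Proof.
suff sym a b : e a b -> e b a by move=> a b; apply/idP/idP; apply: sym.
move=> /asboolP[ab vis]; apply/asboolP; split=> [/esym//|p /vis npab [t t01 pE]].
by apply: npab; exists (1 - t); [lra|rewrite pE subKr addrC].
Qed.

Lemma visibility_graph_irr : irreflexive e.
Proof. by move=> a; apply/asboolP => -[]. Qed.

Lemma not_visible_between a b : a != b -> ~~ e a b -> exists p, between x y p (a, b).
Proof.
move=> ab; apply: contraNP => no; apply/asboolP; split.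
  by move=> /val_inj/eqP; rewrite (negPf ab).
move=> p pP pab; apply: no; exists [` pP]%fset.
exact/open_segment_between.
Qed.

(** A line through [a] and [b] also contains a blocker [s] in [S], outside both sides; at most four
    points on the line leave three for [A] and [B]. *)
Lemma few_collinear_cut A B S : at_most_collinear 4 P -> [disjoint A & B] ->
    [disjoint S & A :|: B] ->
    {in A & B, forall a b, exists2 s, s \in S & between x y s (a, b)} ->
  few_collinear x y A B.
Proof.
move=> col dAB dS blk c c0 a b aA bB la lb.
have ab : a != b by apply: contraTneq bB => <-; rewrite (disjointFr dAB).
have d0 : val b - val a != 0.
  by rewrite subr_eq0 (inj_eq val_inj) eq_sym.
have on_line p : lin x y c p = 0 -> val p \in line (val a) (val b - val a).
  move=> lp; apply/mem_set.
  have eb : c.1.1 * (x b - x a) + c.1.2 * (y b - y a) = 0.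
    by move: la lb; rewrite /lin => la lb; lra.
  have ep : c.1.1 * (x p - x a) + c.1.2 * (y p - y a) = 0.
    by move: la lp; rewrite /lin => la lp; lra.
  (* Both [p - a] and [b - a] are orthogonal to the nonzero normal of the line, hence parallel. The
     parameter of [p] is then the quotient of their entries in a coordinate where [b - a] is
     nonzero. *)
  have det : (x p - x a) * (y b - y a) = (y p - y a) * (x b - x a).
    apply/eqP; rewrite -subr_eq0; case/orP: c0 => c0;
    rewrite -(mulrI_eq0 _ (lregP c0)); apply/eqP.
      transitivity ((y b - y a) * (c.1.1 * (x p - x a) + c.1.2 * (y p - y a)) -
        (y p - y a) * (c.1.1 * (x b - x a) + c.1.2 * (y b - y a))); first by ring.
      by rewrite eb ep; ring.
    transitivity ((x p - x a) * (c.1.1 * (x b - x a) + c.1.2 * (y b - y a)) -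
      (x b - x a) * (c.1.1 * (x p - x a) + c.1.2 * (y p - y a))); first by ring.
    by rewrite eb ep; ring.
  have [xab|xab] := eqVneq (x b - x a) 0; last first.
    exists ((x p - x a) / (x b - x a)); apply: rV2P; rewrite !mxE -/(x _) -/(y _).
      by rewrite divfK // subrKC.
    by rewrite mulrAC det mulfK // subrKC.
  have [yab|yab] := eqVneq (y b - y a) 0.
    by case/eqP: ab; apply: xy_inj; apply/esym/eqP; rewrite -subr_eq0; apply/eqP.
  exists ((y p - y a) / (y b - y a)); apply: rV2P; rewrite !mxE -/(x _) -/(y _).
    by rewrite mulrAC -det mulfK // subrKC.
  by rewrite divfK // subrKC.
have [s sS sab] := blk a b aA bB.
have ls : lin x y c s = 0.
  have [|t _] := @affine_between _ _ x y (lin x y c) _ _ _ sab; first by exists c.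
  by rewrite /along /= la lb !mulr0 addr0.
set Q := [set p in _ | _].
have sQ : s \notin Q.
  by rewrite inE (disjointFr dS sS).
rewrite -ltnS; apply: leq_trans (col _ _ d0).
have <- : #|s |: Q| = #|Q|.+1 by rewrite cardsU1 sQ.
have <- : #|` [fset val p | p in s |: Q]%fset| = #|s |: Q|.
  by rewrite card_imfset ?cardE //; apply: val_inj.
apply/fsubset_leq_card/fsubsetP => _ /imfsetP[p /= pQ ->].
rewrite !finmap.inE /= (valP p) /=; apply: on_line.
by case/setU1P: pQ => [->//|/setIdP[_ /eqP]].
Qed.

(** With [n] the size of the smaller side, [2n <= #|S| + 1] and [delta <= n - 1 + #|S|] give
    [2 delta <= 3 #|S| - 1]. *)
Lemma separates_min_degree A B S : at_most_collinear 4 P ->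
  [disjoint S & A :|: B] -> separates e A B S -> (2 * min_degree e < 3 * #|S|)%N.
Proof.
move=> col dS [dAB A0 B0 nAB cover].
have blk : {in A & B, forall a b, exists2 s, s \in S & between x y s (a, b)}.
  apply: (blockers_between xy_inj dAB cover) => a b aA bB.
  apply: not_visible_between; last exact: nAB.
  by apply: contraTneq bB => <-; rewrite (disjointFr dAB).
have few := few_collinear_cut col dAB dS blk.
(* The larger side is cut down to the size of the smaller one to get balanced sets. *)
have [A' sA cA] := exists_subset_card (geq_minl #|A| #|B|).
have [B' sB cB] := exists_subset_card (geq_minr #|A| #|B|).
have := @card_blockers _ _ x y xy_inj A' B' S _ (few_collinearS sA sB few) _ _ _.
rewrite cA cB leq_min !card_gt0 A0 B0 => /(_ _ _ erefl isT) cS.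
have {}cS : (minn #|A| #|B| + minn #|A| #|B| <= #|S|.+1)%N.
  apply: cS; first by apply: disjointWl sA _; apply: disjointWr sB _.
  by move=> a b /(subsetP sA) aA /(subsetP sB) bB; apply: blk.
have deg : (min_degree e < minn #|A| #|B| + #|S|)%N.
  case/set0Pn: A0 => v vA; case/set0Pn: B0 => w wB.
  rewrite /minn; case: ifP => _.
    apply: leq_ltn_trans (min_degree_le e v) _.
    exact: (degree_le_cut visibility_graph_irr vA nAB cover).
  apply: leq_ltn_trans (min_degree_le e w) _.
  apply: (degree_le_cut visibility_graph_irr wB (B := A)).
    by move=> b a bB aA; rewrite visibility_graph_sym nAB.
  by move=> p /cover; rewrite setUC.
by clear -cS deg; lia.
Qed.

End VisibilityCut.

Theorem theorem18 (R : realType) (P : {fset 'rV[R]_2})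
    (P_ge2 : (1 < #|` P|)%N) (P_col : at_most_collinear 4 P)
    (delta : nat) (deltaE : delta = min_degree (visibility_graph P)) :
  (2 * delta%:R + 1) / 3 <= (connectivity (visibility_graph P))%:R :> rat.
Proof.
(* This is [(2 delta + 1) / 3] rounded up. *)
set k := ((2 * delta + 3) %/ 3)%N.
have cP : #|{: P}| = #|` P| by rewrite -cardfE.
have dP : (delta < #|{: P}|)%N.
  have /card_gt0P[v _] : (0 < #|{: P}|)%N by rewrite cP; apply: ltnW.
  rewrite deltaE; apply: leq_ltn_trans (min_degree_le _ v) _.
  exact: (degree_lt (@visibility_graph_irr R P)).
have kconn : (k <= connectivity (visibility_graph P))%N.
  apply: connectivity_ge => [A B S dS sep|].
    have div3 d s : (2 * d < 3 * s)%N -> ((2 * d + 3) %/ 3 <= s)%N.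
      by clear; lia.
    by rewrite /k deltaE; apply: div3 (separates_min_degree P_col dS sep).
  (* From [d < m] follows [2 d + 3 <= 2 m + 1], which is below [3 m] once [m] exceeds 1; here the
     second point of [P] enters. *)
  have div3 d m : (1 < m)%N -> (d < m)%N -> ((2 * d + 3) %/ 3 < m)%N.
    by clear; lia.
  by apply: div3 dP; rewrite cP.
rewrite ler_pdivrMr // -[2]/(2%:R) -[1]/(1%:R) -[3]/(3%:R) -!natrM -natrD ler_nat.
apply: leq_trans (leq_mul kconn (leqnn 3)); rewrite /k; clear; lia.
Qed.
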